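(* There exists a Hermitian operator $\widetilde W$ on $\mathbb{C}^2\otimes\mathbb{C}^2$ (a witness for steering of imaginarity) such that (i) $\operatorname{Tr}[\widetilde W\rho_{AB}]\ge0$ for every two-qubit state $\rho_{AB}$ with $I_2(\rho_{AB})\le\sqrt2$, and (ii) $\operatorname{Tr}[\widetilde W\rho_{AB}]<0$ for at least one two-qubit state $\rho_{AB}$ with $I_2(\rho_{AB})>\sqrt2$.
   Context: For a two-qubit density matrix $\rho_{AB}$ on $\mathbb{C}^2\otimes\mathbb{C}^2$ (Alice's qubit first, Bob's second), put $n_i=\operatorname{Tr}[(\mathbb{1}_2\otimes\sigma_i)\rho_{AB}]$ and $t_{ii}=\operatorname{Tr}[(\sigma_i\otimes\sigma_i)\rho_{AB}]$ for $i=1,2$, where $\sigma_1=\sigma_x,\sigma_2=\sigma_y$ are Pauli matrices. The imaginarity steering functional is $$I_2(\rho_{AB})=\tfrac12\big(|n_1-t_{11}|+|n_1+t_{11}|+|n_2-t_{22}|+|n_2+t_{22}|\big),$$ and the imaginarity steering inequality is $I_2(\rho_{AB})\le\sqrt2$. *)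

(* Defs.v *)
From HB Require Import structures.
From mathcomp Require Import all_boot all_order all_algebra.
From mathcomp Require Import reals complex mxtens.

Set Implicit Arguments.
Unset Strict Implicit.
Unset Printing Implicit Defensive.

Import Order.TTheory GRing.Theory Num.Theory.
Local Open Scope ring_scope.
Local Open Scope complex_scope.
Local Open Scope sesquilinear_scope.

(* On R[i] the relation x <= y means that x and y have the same imaginary part
   and Re x <= Re y; in particular 0 <= x and x < 0 both entail that x is real. *)

Definition pauli_x (R : realType) : 'M[R[i]]_2 :=
  \matrix_(i, j) (if i == j then 0 else 1).

Definition pauli_y (R : realType) : 'M[R[i]]_2 :=
  \matrix_(i, j) (if i == j then 0 else if (i < j)%N then 0 -i* 1 else 0 +i* 1).

Definition is_density (R : realType) (n : nat) (rho : 'M[R[i]]_n) : Prop :=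
  [/\ rho \is hermsymmx,
      forall v : 'cV[R[i]]_n, 0 <= (v^t* *m rho *m v) 0 0
    & \tr rho = 1].

(* Operators on C^2 (x) C^2 are matrices indexed by 'I_(2 * 2), the index
   2 * a + b standing for |a> (x) |b>, with a on Alice's side. *)

Definition bloch_B (R : realType) (sigma : 'M[R[i]]_2)
    (rho : 'M[R[i]]_(2 * 2)) : R[i] :=
  \tr (((1%:M : 'M[R[i]]_2) *t sigma) *m rho).

Definition corr_AB (R : realType) (sigma : 'M[R[i]]_2)
    (rho : 'M[R[i]]_(2 * 2)) : R[i] :=
  \tr ((sigma *t sigma) *m rho).

(* The modulus on R[i] takes values in R[i], hence so does I2; its values
   are always real. *)
Definition I2 (R : realType) (rho : 'M[R[i]]_(2 * 2)) : R[i] :=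
  let n1 := bloch_B (pauli_x R) rho in
  let n2 := bloch_B (pauli_y R) rho in
  let t11 := corr_AB (pauli_x R) rho in
  let t22 := corr_AB (pauli_y R) rho in
  2^-1 * (`|n1 - t11| + `|n1 + t11| + `|n2 - t22| + `|n2 + t22|).

(* Main.v *)
Require Import Defs.
From mathcomp Require Import all_boot all_order all_algebra.
From mathcomp Require Import reals complex mxtens.
From mathcomp Require Import ring.

(** On states [t11] and [t22] are real, and [|n - t| + |n + t| >= 2 |t|] gives
    [I2 >= |t11| + |t22| >= t11 - t22]. Hence
    [W = sqrt 2 - sigma_x (x) sigma_x + sigma_y (x) sigma_y], whose expectation is
    [sqrt 2 - (t11 - t22)], is nonnegative wherever the inequality holds. The Bell
    state [(|00> + |11>) / sqrt 2] has [t11 = 1] and [t22 = -1], so it gives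
    [sqrt 2 - 2 < 0]. *)

Set Implicit Arguments.
Unset Strict Implicit.
Unset Printing Implicit Defensive.

Import Order.TTheory GRing.Theory Num.Theory.
Local Open Scope ring_scope.
Local Open Scope sesquilinear_scope.

Lemma hermsymmxP (C : numClosedFieldType) n (A : 'M[C]_n) :
  reflect (A^t* = A) (A \is hermsymmx).
Proof.
by apply: (iffP (is_hermitianmxP _ _ _)); rewrite expr0 scale1r => /esym.
Qed.

(** Conjugating the trace amounts to taking the adjoint of the product, which is [B *m A]; cyclicity
    brings back [A *m B], so the trace is its own conjugate. *)
Lemma mxtrace_mul_herm_real (C : numClosedFieldType) n (A B : 'M[C]_n) :
  A \is hermsymmx -> B \is hermsymmx -> \tr (A *m B) \is Num.real.
Proof.
move=> /hermsymmxP hA /hermsymmxP hB.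
apply/CrealP; rewrite -[in LHS]mxtrace_tr -trace_map_mx trmx_mul map_mxM.
by rewrite hA hB mxtrace_mulC.
Qed.

Lemma hermsymmx_tens (C : numClosedFieldType) m n (A : 'M[C]_m) (B : 'M[C]_n) :
  A \is hermsymmx -> B \is hermsymmx -> A *t B \is hermsymmx.
Proof.
move=> /hermsymmxP hA /hermsymmxP hB; apply/hermsymmxP.
by rewrite trmx_tens map_mxT hA hB.
Qed.

Lemma hermsymmx_pauli_x (R : realType) : pauli_x R \is hermsymmx.
Proof.
apply/hermsymmxP/matrixP => i j; rewrite !mxE eq_sym.
by case: eqP; rewrite ?conjC0 ?conjC1.
Qed.

Lemma hermsymmx_pauli_y (R : realType) : pauli_y R \is hermsymmx.
Proof.
apply/hermsymmxP/matrixP => i j; rewrite !mxE eq_sym -val_eqE.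
by case: ltngtP => _ /=; rewrite ?conjC0 //;
  apply/eqP; rewrite eq_complex /= ?oppr0 ?opprK !eqxx.
Qed.

Lemma hermsymmx_pure (C : numClosedFieldType) n (u : 'cV[C]_n) :
  u *m u^t* \is hermsymmx.
Proof.
apply/hermsymmxP; rewrite trmx_mul map_mxM; congr (_ *m _).
by apply/matrixP => i j; rewrite !mxE /= conjCK.
Qed.

(** The form factors as [z^* * z], with [z] the inner product of [u] and [v]. *)
Lemma pure_psd (C : numClosedFieldType) n (u v : 'cV[C]_n) :
  0 <= (v^t* *m (u *m u^t*) *m v) 0 0.
Proof.
rewrite mulmxA -mulmxA mxE big_ord1.
set z := (u^t* *m v) 0 0.
suff -> : (v^t* *m u) 0 0 = z^* by rewrite mulrC mul_conjC_ge0.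
rewrite /z !mxE rmorph_sum; apply: eq_bigr => i _.
by rewrite !mxE rmorphM /= conjCK mulrC.
Qed.

Lemma density_pure (R : realType) n (u : 'cV[R[i]]_n) :
  (u^t* *m u) 0 0 = 1 -> is_density (u *m u^t*).
Proof.
move=> u1; split; [exact: hermsymmx_pure | by move=> v; exact: pure_psd |].
by rewrite mxtrace_mulC /mxtrace big_ord1.
Qed.

(** Triangle inequality for [2 t = (n + t) - (n - t)]. *)
Lemma ler_norm_sub_add (C : numDomainType) (n t : C) :
  `|t| *+ 2 <= `|n - t| + `|n + t|.
Proof.
rewrite -normrMn (_ : t *+ 2 = (n + t) - (n - t)); last by ring.
by rewrite [leRHS]addrC; apply: ler_normB.
Qed.

Definition bell_state (C : numClosedFieldType) : 'cV[C]_(2 * 2) :=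
  (sqrtC 2)^-1 *: \col_k ((mxtens_unindex k).1 == (mxtens_unindex k).2)%:R.

Lemma sqrtC2V_mul (C : numClosedFieldType) :
  (sqrtC 2)^-1 * (sqrtC 2)^-1 = 2^-1 :> C.
Proof. by rewrite -invfM -expr2 sqrtCK. Qed.

(** The Bell vector is supported on [|00>] and [|11>], the first and last indices, so only the four
    corner entries of [A] survive. *)
Lemma bell_expectation (C : numClosedFieldType) (A : 'M[C]_(2 * 2)) :
  \tr (A *m (bell_state C *m (bell_state C)^t*)) =
  2^-1 * (A ord0 ord0 + A ord0 ord_max + A ord_max ord0 + A ord_max ord_max).
Proof.
rewrite mulmxA mxtrace_mulC /mxtrace big_ord1.
rewrite !(mxE, big_ord_recl, big_ord0) /=.
rewrite (_ : lift ord0 (lift ord0 (lift ord0 ord0)) = ord_max);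
  last exact: val_inj.
rewrite !(mulr1, mulr0, conjC0, addr0, add0r, mul0r) /=.
by rewrite geC0_conj ?invr_ge0 ?sqrtC_ge0 // -sqrtC2V_mul; ring.
Qed.

Lemma density_bell (R : realType) :
  is_density (bell_state R[i] *m (bell_state R[i])^t*).
Proof.
apply: density_pure.
(* The norm of the Bell vector is the expectation of the identity. *)
have := bell_expectation (1%:M : 'M[R[i]]_(2 * 2)).
rewrite mul1mx mxtrace_mulC /mxtrace big_ord1 => ->.
by rewrite !mxE /= !addr0 mulVf // pnatr_eq0.
Qed.

Lemma corr_x_bell (R : realType) :
  corr_AB (pauli_x R) (bell_state R[i] *m (bell_state R[i])^t*) = 1.
Proof.
rewrite /corr_AB bell_expectation !mxE /=.
by rewrite !(mulr0, mulr1, addr0, add0r) mulVf // pnatr_eq0.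
Qed.

Lemma corr_y_bell (R : realType) :
  corr_AB (pauli_y R) (bell_state R[i] *m (bell_state R[i])^t*) = -1.
Proof.
rewrite /corr_AB bell_expectation !mxE /=.
rewrite mul0r add0r addr0.
(* The diagonal corners of [sigma_y (x) sigma_y] vanish; the other two are the squares of [-i] and
   [i], both equal to [-1]. *)
have sqrN : (0 -i* 1)%C * (0 -i* 1)%C = -1 :> R[i].
  apply/eqP; rewrite eq_complex /=.
  by rewrite !(mulr0, mul0r, mulr1, mulrNN, oppr0, addr0, sub0r) !eqxx.
rewrite sqrN -expr2 sqr_i -mulr2n -[- 1 *+ 2]mulr_natr mulrCA.
by rewrite mulVf ?mulr1 // pnatr_eq0.
Qed.

Lemma corr_real (R : realType) (sigma : 'M[R[i]]_2) (rho : 'M[R[i]]_(2 * 2)) :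
  sigma \is hermsymmx -> is_density rho -> corr_AB sigma rho \is Num.real.
Proof.
by move=> hs [hr _ _]; apply: mxtrace_mul_herm_real => //; apply: hermsymmx_tens.
Qed.

Lemma corr_sub_le_I2 (R : realType) (rho : 'M[R[i]]_(2 * 2)) :
  is_density rho ->
  corr_AB (pauli_x R) rho - corr_AB (pauli_y R) rho <= I2 rho.
Proof.
move=> rhoP.
(* Reality is essential here: in the partial order of [R[i]], a number lies below its modulus only
   if it is real. *)
have hx := corr_real (hermsymmx_pauli_x R) rhoP.
have hy := corr_real (hermsymmx_pauli_y R) rhoP.
(* With the factor [2^-1] cleared, the four moduli split into an [x] pair and a [y] pair, bounding
   [2 t11] and [-2 t22] respectively. *)
rewrite /I2 mulrC ler_pdivlMr ?ltr0n //.
rewrite mulr_natr mulrnBl -[leRHS]addrA.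
apply: lerD; apply: le_trans (ler_norm_sub_add _ _).
  by rewrite lerMn2r /= real_ler_norm.
by rewrite -mulNrn lerMn2r /= -normrN real_ler_norm ?rpredN.
Qed.

Definition witness (R : realType) : 'M[R[i]]_(2 * 2) :=
  (sqrtC 2)%:M - pauli_x R *t pauli_x R + pauli_y R *t pauli_y R.

Lemma mxtrace_witness (R : realType) (rho : 'M[R[i]]_(2 * 2)) :
  is_density rho ->
  \tr (witness R *m rho) =
  sqrtC 2 - (corr_AB (pauli_x R) rho - corr_AB (pauli_y R) rho).
Proof.
case=> _ _ tr1; rewrite /witness mulmxDl mulmxBl mul_scalar_mx.
by rewrite mxtraceD raddfB /= mxtraceZ tr1 mulr1 opprB addrA addrAC.
Qed.

Lemma hermsymmx_witness (R : realType) : witness R \is hermsymmx.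
Proof.
have /hermsymmxP hx :=
  hermsymmx_tens (hermsymmx_pauli_x R) (hermsymmx_pauli_x R).
have /hermsymmxP hy :=
  hermsymmx_tens (hermsymmx_pauli_y R) (hermsymmx_pauli_y R).
apply/hermsymmxP; rewrite /witness !linearD linearN /= map_mxD map_mxB hx hy.
by rewrite tr_scalar_mx map_scalar_mx /= geC0_conj ?sqrtC_ge0.
Qed.

Lemma sqrtC2_lt2 (C : numClosedFieldType) : sqrtC 2 < 2 :> C.
Proof.
(* Writing [2] as [sqrtC (2 ^+ 2)] reduces the claim to [2 < 4]. *)
rewrite -[ltRHS]sqrCK ?ler0n // ltr_sqrtC ?nnegrE ?exprn_ge0 ?ler0n //.
by rewrite -natrX ltr_nat.
Qed.

Theorem mainTheorem5 (R : realType) :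
  exists W : 'M[R[i]]_(2 * 2),
    [/\ W \is hermsymmx,
        forall rho : 'M[R[i]]_(2 * 2),
          is_density rho -> I2 rho <= sqrtC 2 -> 0 <= \tr (W *m rho)
      & exists rho : 'M[R[i]]_(2 * 2),
          [/\ is_density rho, sqrtC 2 < I2 rho & \tr (W *m rho) < 0]].
Proof.
exists (witness R); split; first exact: hermsymmx_witness.
  move=> rho rhoP leI; rewrite mxtrace_witness // subr_ge0.
  exact: le_trans (corr_sub_le_I2 rhoP) leI.
exists (bell_state R[i] *m (bell_state R[i])^t*).
have bellP := density_bell R.
have bell2 : corr_AB (pauli_x R) (bell_state R[i] *m (bell_state R[i])^t*) -
    corr_AB (pauli_y R) (bell_state R[i] *m (bell_state R[i])^t*) = 2.
  by rewrite corr_x_bell corr_y_bell opprK.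
split=> //; last by rewrite mxtrace_witness // subr_lt0 bell2 sqrtC2_lt2.
(* The bound behind the witness also certifies the violation: it gives [2 <= I2] at the Bell state
   without evaluating [I2]. *)
by apply: lt_le_trans (corr_sub_le_I2 bellP); rewrite bell2 sqrtC2_lt2.
Qed.
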